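(* Let $X$ be a connected 2-complex whose 2-cells have immersed attaching maps. Then $X$ has a totally ordered bislim structure if and only if $X$ has a totally ordered invariant staggering.
   Context: A 2-complex is a 2-dimensional CW complex whose 2-cells $r$ are attached along closed combinatorial paths $\partial_{\mathsf p} r$ (the boundary path) in the 1-skeleton; immersed means locally injective. $\widetilde X$ is the universal cover, with $\pi_1X$ acting by deck transformations. $\partial r$ is the subcomplex of 0-cells and 1-cells traversed by $\partial_{\mathsf p} r$. Bislim structure. A preorder $\preceq$ is a reflexive transitive relation; $a\prec b$ means $a\preceq b$ and not $b\preceq a$. A bislim structure on $X$ consists of: (i) a $\pi_1X$-invariant preorder $\preceq$ on the 1-cells of $\widetilde X$; (ii) for each 2-cell $r$ of $\widetilde X$, distinguished 1-cells $r^+$ and $r^-$ of $\partial r$, such that $r^+$ is traversed exactly once by $\partial_{\mathsf p} r$; such that (iii) $g(r^\pm)=(gr)^\pm$ for each $g\in\pi_1X$ and each 2-cell $r$; (iv) if $r_1\ne r_2$ are 2-cells of $\widetilde X$ and $r_1^+\subset\partial r_2$ then $r_1^+\prec r_2^+$; (v) if $r_1\neq r_2$ are 2-cells of $\widetilde X$ and $r_2^-\subset\partial r_1$ then $r_1^+\prec r_2^+$. The bislim structure is totally ordered if the partial order $\prec$ on the set $\{\alpha^+:\alpha\text{ a 2-cell of }\widetilde X\}$ is a (strict) total order. Totally ordered invariant staggering. It consists of: (1) a $\pi_1X$-invariant total order $\prec$ on the 2-cells of $\widetilde X$; (2) a $\pi_1X$-invariant total order $\prec^+$ on a subset $\mathcal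 E^+$ of the 1-cells of $\widetilde X$; (3) a $\pi_1X$-invariant total order $\prec^-$ on a subset $\mathcal E^-$ of the 1-cells of $\widetilde X$; such that: (4) for each 2-cell $\alpha$ of $\widetilde X$ there are 1-cells of $\mathcal E^+$ and of $\mathcal E^-$ in $\partial\alpha$; let $\max^+(\alpha)$ be the $\prec^+$-highest 1-cell of $\mathcal E^+$ in $\partial\alpha$ and $\min^-(\alpha)$ the $\prec^-$-lowest 1-cell of $\mathcal E^-$ in $\partial\alpha$; (5) $\max^+(\alpha)$ is traversed exactly once by $\partial_{\mathsf p}\alpha$; (6) if $\alpha\prec\beta$ then $\max^+(\alpha)\prec^+\max^+(\beta)$ and $\min^-(\alpha)\prec^-\min^-(\beta)$. *)

(* Defs.v *)
From Stdlib Require Import List Classical ClassicalEpsilon.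
From Stdlib Require Import FunctionalExtensionality PropExtensionality ProofIrrelevance.
Import ListNotations.

Set Implicit Arguments.
Unset Strict Implicit.

(** * 2-complexes *)

(* The 1-cells carry the orientation of their characteristic map; loops and
   multiple edges are allowed. *)
Record graph : Type := Graph {
  vert : Type;
  edge : Type;
  esrc : edge -> vert;
  etgt : edge -> vert
}.

(* [(e, true)] is [e] traversed from [esrc e] to [etgt e], and [(e, false)] is
   its reverse. *)
Definition dart (G : graph) : Type := (edge G * bool)%type.

Definition dsrc (G : graph) (d : dart G) : vert G :=
  if snd d then esrc (fst d) else etgt (fst d).

Definition dtgt (G : graph) (d : dart G) : vert G :=
  if snd d then etgt (fst d) else esrc (fst d).

Definition dinv (G : graph) (d : dart G) : dart G := (fst d, negb (snd d)).

Fixpoint is_path (G : graph) (x : vert G) (p : list (dart G)) (y : vert G) : Prop :=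
  match p with
  | [] => x = y
  | d :: p' => dsrc d = x /\ is_path (dtgt d) p' y
  end.

(* The base vertex of a 2-cell is the starting point of its boundary path; it
   is recorded separately because the boundary path may have length 0. *)
Record complex2 : Type := Complex2 {
  skel :> graph;
  face : Type;
  fbase : face -> vert skel;
  bpath : face -> list (dart skel);
  bpath_closed : forall r, is_path (fbase r) (bpath r) (fbase r)
}.

(* The i-th 1-cell traversed by the boundary path. *)
Definition btrav (X : complex2) (r : face X) (i : nat) : option (edge X) :=
  nth_error (map fst (bpath r)) i.

Definition in_bd (X : complex2) (e : edge X) (r : face X) : Prop :=
  In e (map fst (bpath r)).

Definition traversed_once (X : complex2) (e : edge X) (r : face X) : Prop :=
  exists! i, btrav r i = Some e.

Definition connected (X : complex2) : Prop :=
  inhabited (vert X) /\ forall x y : vert X, exists p, is_path x p y.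

(* A map from the subdivided circle to a graph is locally injective when it is
   not constant and when, at the vertex between the (cyclically) consecutive
   darts [d] and [d'], the two outgoing directions [dinv d] and [d'] differ. *)
Definition immersed_cycle (G : graph) (p : list (dart G)) : Prop :=
  p <> [] /\
  forall i d d', nth_error p i = Some d ->
    nth_error p (Nat.modulo (S i) (length p)) = Some d' ->
    d' <> dinv d.

Definition immersed_attaching_maps (X : complex2) : Prop :=
  forall r : face X, immersed_cycle (bpath r).

(** * Universal covers and deck transformations *)

(* Homotopy rel endpoints of combinatorial paths from [x] to [y]. *)
Inductive homotopic (X : complex2) (x y : vert X) :
    list (dart X) -> list (dart X) -> Prop :=
| htp_refl p : is_path x p y -> homotopic x y p p
| htp_sym p q : homotopic x y p q -> homotopic x y q p
| htp_trans p q s : homotopic x y p q -> homotopic x y q s -> homotopic x y p s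
| htp_spur p d q : is_path x (p ++ [d; dinv d] ++ q) y ->
    homotopic x y (p ++ [d; dinv d] ++ q) (p ++ q)
| htp_face p r q : is_path x (p ++ bpath r ++ q) y ->
    homotopic x y (p ++ bpath r ++ q) (p ++ q).

Definition simply_connected (X : complex2) : Prop :=
  connected X /\
  forall (x : vert X) p, is_path x p x -> homotopic x x p [].

Definition map_dart (G H : graph) (f : edge G -> edge H) (d : dart G) : dart H :=
  (f (fst d), snd d).

(* Cellular maps sending each open cell homeomorphically onto an open cell and
   compatible with the characteristic maps. *)
Record cmap (X Y : complex2) : Type := CMap {
  cV : vert X -> vert Y;
  cE : edge X -> edge Y;
  cF : face X -> face Y;
  cV_src : forall e, cV (esrc e) = esrc (cE e);
  cV_tgt : forall e, cV (etgt e) = etgt (cE e);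
  cV_base : forall r, cV (fbase r) = fbase (cF r);
  cE_bpath : forall r, bpath (cF r) = map (map_dart cE) (bpath r)
}.

(* The 2-cells of the cover above [r] correspond to the lifts of the base
   vertex of [r]: when the boundary path of [r] is a proper power, several
   2-cells of the cover share the same boundary cycle. *)
Record covering (Y X : complex2) (f : cmap Y X) : Prop := Covering {
  cov_dart : forall (y : vert Y) (d : dart X), dsrc d = cV f y ->
    exists! d' : dart Y, dsrc d' = y /\ map_dart (cE f) d' = d;
  cov_face : forall (y : vert Y) (r : face X), fbase r = cV f y ->
    exists! r' : face Y, fbase r' = y /\ cF f r' = r
}.

Record universal_cover (X : complex2) : Type := UniversalCover {
  ucov :> complex2;
  uproj : cmap ucov X;
  ucov_covering : covering uproj;
  ucov_sc : simply_connected ucov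
}.

Definition bijective (A B : Type) (f : A -> B) : Prop :=
  forall b, exists! a, f a = b.

(* The action of the fundamental group of [X] on its universal cover [U] is
   that of the group of deck transformations. *)
Record deck (X : complex2) (U : universal_cover X) : Type := Deck {
  dmap :> cmap U U;
  deckV_bij : bijective (cV dmap);
  deckE_bij : bijective (cE dmap);
  deckF_bij : bijective (cF dmap);
  deckV : forall v, cV (uproj U) (cV dmap v) = cV (uproj U) v;
  deckE : forall e, cE (uproj U) (cE dmap e) = cE (uproj U) e;
  deckF : forall r, cF (uproj U) (cF dmap r) = cF (uproj U) r
}.

(** * Orders *)

Definition strict (A : Type) (le : A -> A -> Prop) (a b : A) : Prop :=
  le a b /\ ~ le b a.

Record strict_total_order_on (A : Type) (P : A -> Prop) (lt : A -> A -> Prop) :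
    Prop := StrictTotalOrderOn {
  sto_irrefl : forall a, P a -> ~ lt a a;
  sto_trans : forall a b c, P a -> P b -> P c -> lt a b -> lt b c -> lt a c;
  sto_total : forall a b, P a -> P b -> a <> b -> lt a b \/ lt b a
}.

(** * Bislim structures *)

Record bislim (X : complex2) (U : universal_cover X) : Type := Bislim {
  ble : edge U -> edge U -> Prop;
  ble_refl : forall a, ble a a;
  ble_trans : forall a b c, ble a b -> ble b c -> ble a c;
  ble_inv : forall (g : deck U) a b, ble (cE g a) (cE g b) <-> ble a b;
  rplus : face U -> edge U;
  rminus : face U -> edge U;
  rplus_bd : forall r, in_bd (rplus r) r;
  rminus_bd : forall r, in_bd (rminus r) r;
  rplus_once : forall r, traversed_once (rplus r) r;
  rplus_inv : forall (g : deck U) r, cE g (rplus r) = rplus (cF g r);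
  rminus_inv : forall (g : deck U) r, cE g (rminus r) = rminus (cF g r);
  bislim_plus : forall r1 r2, r1 <> r2 -> in_bd (rplus r1) r2 ->
    strict ble (rplus r1) (rplus r2);
  bislim_minus : forall r1 r2, r1 <> r2 -> in_bd (rminus r2) r1 ->
    strict ble (rplus r1) (rplus r2)
}.

Definition totally_ordered (X : complex2) (U : universal_cover X) (B : bislim U) :
    Prop :=
  strict_total_order_on (fun e => exists r, e = rplus B r) (strict (ble B)).

(** * Totally ordered invariant staggerings *)

Definition highest (X : complex2) (P : edge X -> Prop) (lt : edge X -> edge X -> Prop)
    (r : face X) (e : edge X) : Prop :=
  (P e /\ in_bd e r) /\
  forall e', P e' -> in_bd e' r -> e' <> e -> lt e' e.

Definition lowest (X : complex2) (P : edge X -> Prop) (lt : edge X -> edge X -> Prop)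
    (r : face X) (e : edge X) : Prop :=
  (P e /\ in_bd e r) /\
  forall e', P e' -> in_bd e' r -> e' <> e -> lt e e'.

(* The relations [ltp] and [ltm] are only meaningful on [Ep] and [Em].  By
   [stg_exp] and finiteness of the boundary path, each 2-cell [r] has exactly
   one [highest Ep ltp r] 1-cell, and similarly for [lowest Em ltm r]. *)
Record staggering (X : complex2) (U : universal_cover X) : Type := Staggering {
  ltf : face U -> face U -> Prop;
  ltf_total : strict_total_order_on (fun _ => True) ltf;
  ltf_inv : forall (g : deck U) r s, ltf (cF g r) (cF g s) <-> ltf r s;
  Ep : edge U -> Prop;
  ltp : edge U -> edge U -> Prop;
  Ep_inv : forall (g : deck U) e, Ep (cE g e) <-> Ep e;
  ltp_total : strict_total_order_on Ep ltp;
  ltp_inv : forall (g : deck U) a b, Ep a -> Ep b ->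
    (ltp (cE g a) (cE g b) <-> ltp a b);
  Em : edge U -> Prop;
  ltm : edge U -> edge U -> Prop;
  Em_inv : forall (g : deck U) e, Em (cE g e) <-> Em e;
  ltm_total : strict_total_order_on Em ltm;
  ltm_inv : forall (g : deck U) a b, Em a -> Em b ->
    (ltm (cE g a) (cE g b) <-> ltm a b);
  stg_exp : forall r, exists e, Ep e /\ in_bd e r;
  stg_exm : forall r, exists e, Em e /\ in_bd e r;
  stg_once : forall r e, highest Ep ltp r e -> traversed_once e r;
  stg_max : forall r s a b, ltf r s ->
    highest Ep ltp r a -> highest Ep ltp s b -> ltp a b;
  stg_min : forall r s a b, ltf r s ->
    lowest Em ltm r a -> lowest Em ltm s b -> ltm a b
}.

Definition has_totally_ordered_bislim (X : complex2) (U : universal_cover X) : Prop :=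
  exists B : bislim U, totally_ordered B.

Definition has_totally_ordered_invariant_staggering
    (X : complex2) (U : universal_cover X) : Prop :=
  inhabited (staggering U).

(** * Existence of universal covers *)

Section Paths.
Variable X : complex2.
Implicit Types (x y z : vert X) (p q : list (dart X)).

Lemma is_path_app x p q y :
  is_path x (p ++ q) y <-> exists z, is_path x p z /\ is_path z q y.
Proof.
revert x; induction p as [|d p IH]; intro x; simpl.
- split; [intro h; exists x; auto | intros [z [-> h]]; auto].
- rewrite IH; split; [intros [h [z [h1 h2]]] | intros [z [[h h1] h2]]]; eauto 6.
Qed.

Lemma is_path_end x p y z : is_path x p y -> is_path x p z -> y = z.
Proof.
revert x; induction p as [|d p IH]; simpl; intro x.
- congruence.
- intros [_ h] [_ k]; eauto.
Qed.

Lemma dsrc_inv (d : dart X) : dsrc (dinv d) = dtgt d.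
Proof. destruct d as [e []]; reflexivity. Qed.

Lemma dtgt_inv (d : dart X) : dtgt (dinv d) = dsrc d.
Proof. destruct d as [e []]; reflexivity. Qed.

Lemma dinv_inv (d : dart X) : dinv (dinv d) = d.
Proof. destruct d as [e []]; reflexivity. Qed.

Lemma htp_paths x y p q : homotopic x y p q -> is_path x p y /\ is_path x q y.
Proof.
induction 1 as [p h|p q _ IH|p q s _ IH1 _ IH2|p d q h|p r q h]; try tauto.
- split; auto. rewrite is_path_app in h |- *. destruct h as [z [h1 h2]].
  simpl in h2. destruct h2 as [<- [_ h2]]. rewrite dtgt_inv in h2; eauto.
- split; auto. rewrite is_path_app in h |- *. destruct h as [z [h1 h2]].
  exists z; split; auto. rewrite is_path_app in h2. destruct h2 as [w [h2 h3]].
  destruct (bpath r) as [|d l] eqn:E; simpl in h2; [congruence|].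
  pose proof (bpath_closed r) as c. rewrite E in c; simpl in c.
  destruct c as [c1 c2], h2 as [k1 k2].
  rewrite (is_path_end k2 c2) in h3. congruence.
Qed.

Lemma htp_ctx x y z w a b p q : is_path x a z -> is_path w b y ->
  homotopic z w p q -> homotopic x y (a ++ p ++ b) (a ++ q ++ b).
Proof.
intros ha hb; induction 1 as [p h|p q _ IH|p q s _ IH1 _ IH2|p d q h|p r q h].
- apply htp_refl. rewrite is_path_app. exists z; split; auto.
  rewrite is_path_app; eauto.
- apply htp_sym; auto.
- eapply htp_trans; eauto.
- replace (a ++ (p ++ [d; dinv d] ++ q) ++ b)
    with ((a ++ p) ++ [d; dinv d] ++ (q ++ b)) by (rewrite <- !app_assoc; reflexivity).
  replace (a ++ (p ++ q) ++ b) with ((a ++ p) ++ (q ++ b))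
    by (rewrite <- !app_assoc; reflexivity).
  apply htp_spur.
  replace ((a ++ p) ++ [d; dinv d] ++ (q ++ b))
    with (a ++ (p ++ [d; dinv d] ++ q) ++ b) by (rewrite <- !app_assoc; reflexivity).
  rewrite is_path_app. exists z; split; auto. rewrite is_path_app; eauto.
- replace (a ++ (p ++ bpath r ++ q) ++ b)
    with ((a ++ p) ++ bpath r ++ (q ++ b)) by (rewrite <- !app_assoc; reflexivity).
  replace (a ++ (p ++ q) ++ b) with ((a ++ p) ++ (q ++ b))
    by (rewrite <- !app_assoc; reflexivity).
  apply htp_face.
  replace ((a ++ p) ++ bpath r ++ (q ++ b))
    with (a ++ (p ++ bpath r ++ q) ++ b) by (rewrite <- !app_assoc; reflexivity).
  rewrite is_path_app. exists z; split; auto. rewrite is_path_app; eauto.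
Qed.

Lemma htp_appr x y z p q b : is_path z b y ->
  homotopic x z p q -> homotopic x y (p ++ b) (q ++ b).
Proof. intros hb h. exact (htp_ctx (a := []) eq_refl hb h). Qed.

Lemma htp_appl x y z a p q : is_path x a z ->
  homotopic z y p q -> homotopic x y (a ++ p) (a ++ q).
Proof.
intros ha h.
pose proof (htp_ctx ha (b := []) (y := y) (w := y) eq_refl h) as k.
now rewrite !app_nil_r in k.
Qed.

Definition rpath p : list (dart X) := rev (map (@dinv X) p).

Lemma is_path_rpath x p y : is_path x p y -> is_path y (rpath p) x.
Proof.
revert x; induction p as [|d p IH]; simpl; intros x.
- congruence.
- intros [h1 h2]. unfold rpath; simpl. rewrite is_path_app. exists (dtgt d); split.
  + apply IH; auto.
  + simpl. rewrite dsrc_inv, dtgt_inv; auto.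
Qed.

Lemma rpath_rpath p : rpath (rpath p) = p.
Proof.
unfold rpath. rewrite map_rev, rev_involutive, map_map.
rewrite <- (map_id p) at 2. apply map_ext; intro; apply dinv_inv.
Qed.

Lemma htp_rpathr x p y : is_path x p y -> homotopic x x (p ++ rpath p) [].
Proof.
revert x; induction p as [|d p IH]; intros x; simpl.
- intros _. apply htp_refl; reflexivity.
- intros [h1 h2]. unfold rpath; simpl. fold (rpath p).
  apply htp_trans with (d :: dinv d :: []).
  + replace (d :: p ++ rpath p ++ [dinv d]) with ([d] ++ (p ++ rpath p) ++ [dinv d])
      by (simpl; rewrite <- app_assoc; reflexivity).
    change (d :: dinv d :: []) with ([d] ++ [] ++ [dinv d]).
    apply htp_ctx with (z := dtgt d) (w := dtgt d); simpl; auto.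
    rewrite dsrc_inv, dtgt_inv; auto.
  + apply (htp_spur (p := []) (q := [])). simpl. rewrite dsrc_inv, dtgt_inv; auto.
Qed.

Lemma htp_rpathl x p y : is_path x p y -> homotopic y y (rpath p ++ p) [].
Proof.
intros h. pose proof (htp_rpathr (is_path_rpath h)) as k. now rewrite rpath_rpath in k.
Qed.

End Paths.

Section PathLifting.
Variables (Y X : complex2) (f : cmap Y X).
Hypothesis cov : covering f.
Local Notation mp := (map (map_dart (cE f))).

Lemma dsrc_map (d : dart Y) : dsrc (map_dart (cE f) d) = cV f (dsrc d).
Proof. destruct d as [e []]; unfold dsrc; simpl; now rewrite ?cV_src, ?cV_tgt. Qed.

Lemma dtgt_map (d : dart Y) : dtgt (map_dart (cE f) d) = cV f (dtgt d).
Proof. destruct d as [e []]; unfold dtgt; simpl; now rewrite ?cV_src, ?cV_tgt. Qed.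

Lemma is_path_map (y : vert Y) l z : is_path y l z -> is_path (cV f y) (mp l) (cV f z).
Proof.
revert y; induction l as [|d l IH]; simpl; intro y; [congruence|].
intros [<- h]. rewrite dsrc_map, dtgt_map. auto.
Qed.

Lemma lift_uniq (y : vert Y) l l' z z' : is_path y l z -> is_path y l' z' ->
  mp l = mp l' -> l = l'.
Proof.
revert y l'; induction l as [|d l IH]; intros y [|d' l']; cbn [map is_path]; try easy.
intros [h1 h2] [k1 k2] e. injection e as e1 e2 e3.
assert (d = d').
{ destruct (cov_dart cov (y := y) (d := map_dart (cE f) d)) as [u [_ U]].
  { rewrite dsrc_map; congruence. }
  assert (E : map_dart (cE f) d' = map_dart (cE f) d) by (unfold map_dart; congruence).
  rewrite <- (U d), <- (U d'); auto. }
subst d'. f_equal. eapply IH; eauto.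
Qed.

Lemma lift_ex (y : vert Y) l w : is_path (cV f y) l w ->
  exists l' z, is_path y l' z /\ mp l' = l.
Proof.
revert y; induction l as [|d l IH]; simpl; intro y.
- intros _. exists [], y; simpl; auto.
- intros [h1 h2]. destruct (cov_dart cov h1) as [d' [[k1 k2] _]].
  rewrite <- k2, dtgt_map in h2. destruct (IH _ h2) as [l' [z [a b]]].
  exists (d' :: l'), z; simpl. rewrite b, k2. auto.
Qed.

Lemma htp_lift x w p q : homotopic x w p q ->
  (forall y z p', cV f y = x -> is_path y p' z -> mp p' = p ->
    exists q', mp q' = q /\ homotopic y z p' q') /\
  (forall y z q', cV f y = x -> is_path y q' z -> mp q' = q ->
    exists p', mp p' = p /\ homotopic y z p' q').
Proof.
induction 1 as [p h|p q _ [IH1 IH2]|p q s _ [I1 I2] _ [J1 J2]|p d q h|p r q h].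
- split; intros y z p' hy hp e; exists p'; split; auto; now apply htp_refl.
- split; intros y z p' hy hp e.
  + destruct (IH2 y z p' hy hp e) as [q' [? ?]]. exists q'; split; auto; now apply htp_sym.
  + destruct (IH1 y z p' hy hp e) as [q' [? ?]]. exists q'; split; auto; now apply htp_sym.
- split; intros y z p' hy hp e.
  + destruct (I1 y z p' hy hp e) as [q' [e1 h1]].
    destruct (J1 y z q' hy (proj2 (htp_paths h1)) e1) as [s' [e2 h2]].
    exists s'; split; auto; eapply htp_trans; eauto.
  + destruct (J2 y z p' hy hp e) as [q' [e1 h1]].
    destruct (I2 y z q' hy (proj1 (htp_paths h1)) e1) as [s' [e2 h2]].
    exists s'; split; auto; eapply htp_trans; eauto.
- split; intros y z p' hy hp e.
  + apply map_eq_app in e as (a & b & -> & <- & e).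
    apply map_eq_app in e as (c & b' & -> & e & <-).
    rewrite is_path_app in hp. destruct hp as [u [ha hb]].
    destruct c as [|d1 [|d2 [|]]]; try discriminate.
    assert (e1 : map_dart (cE f) d1 = d) by exact (f_equal (hd d) e).
    assert (e2 : map_dart (cE f) d2 = dinv d) by exact (f_equal (fun l => nth 1 l d) e).
    assert (d2 = dinv d1).
    { simpl in hb. destruct hb as [_ [hb _]].
      assert (L : [d2] = [dinv d1]).
      { apply (lift_uniq (y := dtgt d1) (z := dtgt d2) (z' := dsrc d1));
          simpl; rewrite ?dsrc_inv, ?dtgt_inv; auto.
        rewrite e2, <- e1. reflexivity. }
      congruence. }
    subst d2. exists (a ++ b'). rewrite map_app. split; auto.
    apply htp_spur. rewrite is_path_app; eauto.
  + apply map_eq_app in e as (a & b & -> & <- & <-).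
    rewrite is_path_app in hp. destruct hp as [u [ha hb]].
    rewrite is_path_app in h. destruct h as [v [h1 [h2 _]]].
    subst x. pose proof (is_path_end h1 (is_path_map ha)) as ->.
    destruct (cov_dart cov h2) as [d' [[k1 k2] _]].
    exists (a ++ [d'; dinv d'] ++ b). split.
    * rewrite !map_app. subst d. reflexivity.
    * apply htp_spur. rewrite is_path_app. exists u; split; auto.
      simpl. rewrite dsrc_inv, dtgt_inv. subst u; auto.
- destruct (bpath r) as [|d l] eqn:E.
  { simpl in *. split; intros y z p' hy hp e; exists p'; split; auto; now apply htp_refl. }
  rewrite <- E in *.
  assert (B : forall v w', is_path v (bpath r ++ q) w' -> v = fbase r).
  { intros v w' k. pose proof (bpath_closed r) as c. rewrite E in k, c; simpl in k, c.
    destruct k, c; congruence. }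
  clear E d l.
  split; intros y z p' hy hp e.
  + apply map_eq_app in e as (a & b & -> & <- & e).
    apply map_eq_app in e as (c & b' & -> & e & <-).
    rewrite is_path_app in hp. destruct hp as [u [ha hb]].
    assert (Bu : fbase r = cV f u).
    { symmetry; apply (B _ (cV f z)). apply is_path_map in hb. rewrite map_app, e in hb. auto. }
    destruct (cov_face cov Bu) as [r' [[k1 k2] _]].
    assert (hb' := hb). rewrite is_path_app in hb'. destruct hb' as [v [hc _]].
    assert (c = bpath r').
    { apply (lift_uniq (y := u) (z := v) (z' := u)); auto.
      - pose proof (bpath_closed r'). congruence.
      - rewrite e, <- k2. apply cE_bpath. }
    subst c. exists (a ++ b'). rewrite map_app. split; auto.
    apply htp_face. rewrite is_path_app; eauto.
  + apply map_eq_app in e as (a & b & -> & <- & <-).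
    rewrite is_path_app in hp. destruct hp as [u [ha hb]].
    rewrite is_path_app in h. destruct h as [v [h1 h2]].
    subst x. pose proof (is_path_end h1 (is_path_map ha)) as ->.
    apply B in h2. destruct (cov_face cov (eq_sym h2)) as [r' [[k1 k2] _]].
    exists (a ++ bpath r' ++ b). split.
    * rewrite !map_app. now rewrite <- cE_bpath, k2.
    * apply htp_face. rewrite is_path_app. exists u; split; auto.
      rewrite is_path_app. exists u; split; auto.
      pose proof (bpath_closed r'). congruence.
Qed.

End PathLifting.

Section Construction.
Variables (X : complex2) (x0 : vert X).

(* A vertex of the cover is a homotopy class of paths starting at [x0]. *)
Record pclass : Type := PClass {
  pend : vert X;
  pcl : list (dart X) -> Prop;
  pcl_ex : exists p, is_path x0 p pend /\ pcl = homotopic x0 pend p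
}.

Definition mkclass p y (h : is_path x0 p y) : pclass :=
  PClass (ex_intro _ p (conj h eq_refl)).

Lemma pclass_ext (u v : pclass) : pend u = pend v -> pcl u = pcl v -> u = v.
Proof.
destruct u as [a b c], v as [a' b' c']; simpl. intros <- <-.
f_equal; apply proof_irrelevance.
Qed.

Lemma mkclass_ex (v : pclass) : exists p (h : is_path x0 p (pend v)), v = mkclass h.
Proof.
destruct (pcl_ex v) as [p [h e]]. exists p, h. apply pclass_ext; auto.
Qed.

Lemma htp_class y p q : homotopic x0 y p q -> homotopic x0 y p = homotopic x0 y q.
Proof.
intro h. apply functional_extensionality; intro s. apply propositional_extensionality.
split; intro k; eapply htp_trans; eauto. apply htp_sym; auto.
Qed.

Lemma mkclass_eq p q y (h : is_path x0 p y) (k : is_path x0 q y) :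
  mkclass h = mkclass k <-> homotopic x0 y p q.
Proof.
split.
- intro e. apply (f_equal pcl) in e; simpl in e. rewrite e. now apply htp_refl.
- intro e. apply pclass_ext; simpl; auto. now apply htp_class.
Qed.

Definition pstep_cl (v : pclass) (d : dart X) : list (dart X) -> Prop :=
  fun q => exists p, pcl v p /\ homotopic x0 (dtgt d) (p ++ [d]) q.

Lemma pstep_clE (v : pclass) p (d : dart X) : dsrc d = pend v ->
  is_path x0 p (pend v) -> pcl v = homotopic x0 (pend v) p ->
  is_path x0 (p ++ [d]) (dtgt d) /\ pstep_cl v d = homotopic x0 (dtgt d) (p ++ [d]).
Proof.
intros hd hp e.
assert (k : is_path x0 (p ++ [d]) (dtgt d)).
{ rewrite is_path_app. exists (pend v); simpl; auto. }
split; auto.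
apply functional_extensionality; intro q. apply propositional_extensionality.
unfold pstep_cl. rewrite e. split.
- intros [p' [h1 h2]]. eapply htp_trans; [|exact h2].
  apply htp_appr with (pend v); simpl; auto.
- intro h. exists p; split; auto. now apply htp_refl.
Qed.

Lemma pstep_ex (v : pclass) (d : dart X) (hd : dsrc d = pend v) :
  exists p, is_path x0 p (dtgt d) /\ pstep_cl v d = homotopic x0 (dtgt d) p.
Proof.
destruct (pcl_ex v) as [p [h e]]. exists (p ++ [d]). now apply pstep_clE.
Qed.

Definition pstep (v : pclass) (d : dart X) (hd : dsrc d = pend v) : pclass :=
  PClass (pstep_ex hd).

Lemma pstep_mk p y (h : is_path x0 p y) (d : dart X) (hd : dsrc d = y)
    (k : is_path x0 (p ++ [d]) (dtgt d)) :
  pstep (v := mkclass h) hd = mkclass k.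
Proof. apply pclass_ext; simpl; auto. apply (pstep_clE (v := mkclass h)); auto. Qed.

Record cedge : Type := CEdge {
  ce_src : pclass;
  ce_edge : edge X;
  ce_ok : dsrc (ce_edge, true) = pend ce_src
}.

Definition cgraph : graph :=
  Graph ce_src (fun e : cedge => pstep (ce_ok e)).

Local Notation cdown := (@map_dart cgraph (skel X) ce_edge).

Lemma cedge_ext (a b : cedge) : ce_src a = ce_src b -> ce_edge a = ce_edge b -> a = b.
Proof.
destruct a as [u e h], b as [u' e' h']; simpl. intros <- <-.
f_equal; apply proof_irrelevance.
Qed.

Lemma cdart_src (d : dart cgraph) : pend (dsrc d) = dsrc (cdown d).
Proof. destruct d as [[v e h] []]; unfold dsrc; simpl; auto. Qed.

Lemma cdart_tgt (d : dart cgraph) : pend (dtgt d) = dtgt (cdown d).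
Proof. destruct d as [[v e h] []]; unfold dtgt; simpl; auto. Qed.

Lemma cdart_step (d : dart cgraph) p y (h : is_path x0 p y) : dsrc d = mkclass h ->
  exists k : is_path x0 (p ++ [cdown d]) (pend (dtgt d)),
    dtgt d = mkclass k.
Proof.
destruct d as [[v e ok] []]; unfold dsrc, dtgt; cbn [snd fst esrc etgt cgraph ce_src].
- intros ->. unfold map_dart; cbn [fst snd ce_edge].
  assert (k : is_path x0 (p ++ [(e, true)]) (dtgt (e, true))).
  { rewrite is_path_app. exists y; simpl; auto. }
  exists k. apply pstep_mk.
- destruct (mkclass_ex v) as [q [hq E]]. revert ok. rewrite E. cbn [pend mkclass].
  intros ok e0. unfold map_dart; cbn [fst snd ce_edge].
  set (v' := pend v) in *. clearbody v'. clear E v.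
  assert (k : is_path x0 (q ++ [(e, true)]) (dtgt (e, true))).
  { rewrite is_path_app. exists v'; simpl; auto. }
  cbn [ce_ok] in e0.
  change (pstep (v := mkclass hq) ok = mkclass h) in e0.
  rewrite (pstep_mk hq ok k) in e0.
  assert (y = dtgt (e, true)) by now apply (f_equal pend) in e0.
  subst y. apply mkclass_eq in e0.
  assert (P : is_path x0 (p ++ [(e, false)]) v').
  { rewrite is_path_app. exists (dtgt (e, true)); split; auto. split; [reflexivity|]. exact ok. }
  exists P. apply mkclass_eq.
  apply htp_trans with ((q ++ [(e, true)]) ++ [(e, false)]).
  + apply htp_sym. rewrite <- app_assoc.
    assert (W : is_path x0 (q ++ [(e, true); dinv (G := X) (e, true)] ++ []) v').
    { rewrite is_path_app. exists v'; split; auto. simpl. split; [exact ok|].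
      split; [reflexivity|exact ok]. }
    pose proof (htp_spur W) as k'. rewrite !app_nil_r in k'. exact k'.
  + apply htp_appr with (dtgt (e, true)); auto.
    split; [reflexivity|]. exact ok.
Qed.

Lemma cpath_end (l : list (dart cgraph)) v w p y (h : is_path x0 p y) :
  is_path v l w -> v = mkclass h ->
  exists k : is_path x0 (p ++ map cdown l) (pend w), w = mkclass k.
Proof.
revert v p y h; induction l as [|d l IH]; simpl; intros v p y h.
- intros <- ->. rewrite app_nil_r. exists h. reflexivity.
- intros [hd hl] ->. destruct (cdart_step hd) as [k e].
  destruct (IH _ _ _ k hl e) as [k' e']. revert k' e'. rewrite <- app_assoc.
  intros k' e'. exists k'. exact e'.
Qed.

Lemma cdart_ex (v : pclass) (d : dart X) : dsrc d = pend v ->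
  exists! d' : dart cgraph, dsrc d' = v /\ cdown d' = d.
Proof.
intro hd. destruct d as [e []].
- exists (CEdge hd, true). split; [split; reflexivity|].
  intros [e' b] [h1 h2]. unfold map_dart in h2; simpl in h2. injection h2 as h2 h3.
  subst b. f_equal. apply cedge_ext; simpl; auto.
- pose proof (dsrc_inv (e, false)) as ok'. simpl in ok'.
  assert (ok : dsrc (e, true) = pend (pstep hd)) by reflexivity.
  destruct (mkclass_ex v) as [p [hp ev]].
  assert (tgt_eq : forall (u : pclass) (o : dsrc (e, true) = pend u),
    pstep o = v <-> u = pstep hd).
  { intros u o.
    pose proof (cdart_step (d := (CEdge o, true))) as A.
    pose proof (cdart_step (d := (CEdge o, false))) as B.
    unfold dsrc, dtgt, map_dart in A, B; cbn [snd fst esrc etgt cgraph ce_src ce_ok ce_edge] in A, B.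
    assert (kv : is_path x0 (p ++ [(e, false)]) (dtgt (e, false))).
    { rewrite is_path_app. exists (pend v); simpl; auto. }
    assert (sv : pstep hd = mkclass kv).
    { apply pclass_ext; simpl; auto. apply (pstep_clE (v := v)); auto.
      rewrite ev at 1; reflexivity. }
    split.
    - intro s. destruct (B p (pend v) hp) as [k E]; [congruence|].
      rewrite sv, E. apply pclass_ext; simpl; auto.
      now rewrite <- o.
    - intro s. assert (s' : u = mkclass kv) by congruence.
      destruct (A _ _ kv s') as [k E]. rewrite E, ev.
      apply pclass_ext; [exact hd|]. simpl.
      assert (D : dtgt (G := X) (e, true) = pend v) by exact hd.
      rewrite D. apply htp_class.
      rewrite <- app_assoc.
      assert (W : is_path x0 (p ++ [(e, false); dinv (G := X) (e, false)] ++ []) (pend v)).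
      { rewrite is_path_app. exists (pend v); split; auto. simpl.
        split; [exact hd|]. split; [reflexivity|]. exact D. }
      pose proof (htp_spur W) as k'. rewrite !app_nil_r in k'. exact k'. }
  exists (CEdge ok, false). split.
  + split; [|reflexivity]. apply tgt_eq. reflexivity.
  + intros [[u e' o] b] [h1 h2]. unfold map_dart in h2; simpl in h2. injection h2 as h2 h3.
    subst b e'. f_equal. apply cedge_ext; simpl; auto. symmetry. apply (tgt_eq u o). exact h1.
Qed.

Lemma clift_ex (v : pclass) l w : is_path (pend v) l w ->
  exists l' : list (dart cgraph),
    map cdown l' = l /\ exists z, is_path (G := cgraph) v l' z.
Proof.
revert v; induction l as [|d l IH]; simpl; intro v.
- intros _. exists []; simpl; eauto.
- intros [h1 h2]. destruct (cdart_ex h1) as [d' [[k1 k2] _]].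
  assert (h3 : is_path (pend (dtgt d')) l w) by now rewrite cdart_tgt, k2.
  destruct (IH _ h3) as [l' [a [z b]]].
  exists (d' :: l'); simpl. rewrite a, k2. eauto.
Qed.

Record cface : Type := CFace {
  cf_base : pclass;
  cf_face : face X;
  cf_ok : fbase cf_face = pend cf_base
}.

Lemma cface_ext (a b : cface) : cf_base a = cf_base b -> cf_face a = cf_face b -> a = b.
Proof.
destruct a as [u e h], b as [u' e' h']; simpl. intros <- <-.
f_equal; apply proof_irrelevance.
Qed.

Lemma cface_lift (r : cface) : exists l : list (dart cgraph),
  map cdown l = bpath (cf_face r) /\
  is_path (G := cgraph) (cf_base r) l (cf_base r).
Proof.
destruct r as [v r ok]; simpl.
pose proof (bpath_closed r) as c. rewrite ok in c.
destruct (clift_ex c) as [l [e [z h]]]. exists l; split; auto.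
destruct (mkclass_ex v) as [p [hp ev]].
destruct (cpath_end h ev) as [k ez]. revert k ez; rewrite e; intros k ez.
assert (ze : pend z = pend v).
{ assert (c' := k). rewrite is_path_app in c'. destruct c' as [u [c1 c2]].
  rewrite (is_path_end c1 hp) in c2. exact (is_path_end c2 c). }
replace v with z at 2; auto.
rewrite ez, ev. apply pclass_ext; simpl; auto.
rewrite ze. apply htp_class.
assert (W : is_path x0 (p ++ bpath r ++ []) (pend v)) by now rewrite app_nil_r, <- ze.
pose proof (htp_face W) as k'. now rewrite !app_nil_r in k'.
Qed.

Definition cbpath (r : cface) : list (dart cgraph) :=
  proj1_sig (constructive_indefinite_description _ (cface_lift r)).

Lemma cbpath_spec (r : cface) :
  map cdown (cbpath r) = bpath (cf_face r) /\
  is_path (G := cgraph) (cf_base r) (cbpath r) (cf_base r).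
Proof. unfold cbpath. destruct constructive_indefinite_description; auto. Qed.

Definition ccomplex : complex2 :=
  @Complex2 cgraph cface cf_base cbpath (fun r => proj2 (cbpath_spec r)).

Definition cproj : cmap ccomplex X :=
  @CMap ccomplex X pend ce_edge cf_face
    (fun e => eq_sym (ce_ok e)) (fun e => eq_refl)
    (fun r => eq_sym (cf_ok r)) (fun r => eq_sym (proj1 (cbpath_spec r))).

Lemma cproj_covering : covering cproj.
Proof.
split.
- exact cdart_ex.
- intros v r h. exists (CFace h). split; [split; reflexivity|].
  intros r' [h1 h2]. apply cface_ext; simpl; auto.
Qed.

Lemma ccomplex_sc : simply_connected ccomplex.
Proof.
set (v0 := mkclass (p := []) (y := x0) eq_refl).
assert (reach : forall v : vert ccomplex, exists l, is_path (G := ccomplex) v0 l v).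
{ intro v. destruct (mkclass_ex v) as [p [hp ev]].
  destruct (clift_ex (v := v0) hp) as [l [e [z h]]].
  destruct (cpath_end h (p := []) (h := eq_refl) eq_refl) as [k ez].
  simpl in k, ez. revert k ez; rewrite e; intros k ez. pose proof (is_path_end k hp) as E.
  exists l. replace v with z; auto. rewrite ez, ev. apply pclass_ext; simpl; auto.
  now rewrite E. }
split; [split|].
- exact (inhabits v0).
- intros u v. destruct (reach u) as [a ha], (reach v) as [b hb].
  exists (rpath (X := ccomplex) a ++ b). rewrite is_path_app. exists v0; split; auto.
  now apply is_path_rpath.
- intros v l hl. destruct (reach v) as [a ha].
  assert (hal : is_path (G := ccomplex) v0 (a ++ l) v) by (rewrite is_path_app; eauto).
  destruct (cpath_end ha (p := []) (h := eq_refl) eq_refl) as [k1 e1].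
  destruct (cpath_end hal (p := []) (h := eq_refl) eq_refl) as [k2 e2].
  simpl in k1, k2, e1, e2.
  assert (H : homotopic x0 (pend v) (map cdown (a ++ l))
    (map cdown a)).
  { apply (mkclass_eq k2 k1). congruence. }
  destruct (htp_lift cproj_covering H) as [L _].
  destruct (L v0 v (a ++ l) eq_refl hal eq_refl) as [a' [ea ka]].
  assert (a' = a).
  { apply (lift_uniq cproj_covering (proj2 (htp_paths ka)) ha). exact ea. }
  subst a'.
  pose proof (is_path_rpath (X := ccomplex) ha) as hr.
  pose proof (htp_rpathl (X := ccomplex) ha) as hc.
  pose proof (htp_appl hr ka) as K.
  apply htp_trans with (rpath (X := ccomplex) a ++ a ++ l).
  + rewrite app_assoc. apply htp_sym. exact (htp_appr hl hc).
  + eapply htp_trans; [exact K|exact hc].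
Qed.

Definition universal_cover_at : universal_cover X :=
  UniversalCover cproj_covering ccomplex_sc.

End Construction.

Theorem universal_cover_exists (X : complex2) :
  connected X -> inhabited (universal_cover X).
Proof. intros [[x0] _]. exact (inhabits (universal_cover_at x0)). Qed.

(* Main.v *)
Require Import Defs.
From Stdlib Require Import List Classical ClassicalEpsilon.

Set Implicit Arguments.
Unset Strict Implicit.

(** In a bislim structure, conditions (iv) and (v) force both [r ↦ r^+] and
    [r ↦ r^-] to be injective, so the order of the 1-cells [r^+] transports to
    the 2-cells and to the 1-cells [r^-]; the same conditions say that [r^+] is
    the highest [s^+] and [r^-] the lowest [s^-] in the boundary of [r].
    Conversely, a staggering yields [r^+ := max^+ r], [r^- := min^- r], with [a ⪯ b]
    when [a = b] or [a ≺^+ b] in [E^+]; if [min^- s] lies in the boundary of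
    [r ≠ s], then [s ≺ r] is impossible, whence [r ≺ s] and
    [max^+ r ≺^+ max^+ s]. *)

(** * Strict total orders on a subset *)

(** For the reversed relation, [highest] unfolds to [lowest]; through this lemma the facts about
    [highest] also serve for [lowest]. *)
Lemma sto_flip (A : Type) (P : A -> Prop) (lt : A -> A -> Prop) :
  strict_total_order_on P lt -> strict_total_order_on P (fun a b => lt b a).
Proof.
intros [I T C]; split; [exact I | | ].
- intros a b c pa pb pc ab bc. exact (T c b a pc pb pa bc ab).
- intros a b pa pb ne. destruct (C a b pa pb ne); auto.
Qed.

Lemma sto_asym (A : Type) (P : A -> Prop) (lt : A -> A -> Prop) a b :
  strict_total_order_on P lt -> P a -> P b -> lt a b -> ~ lt b a.
Proof.
intros [I T _] pa pb ab ba. exact (I a pa (T a b a pa pb pa ab ba)).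
Qed.

(** Induction on [l]: the head is compared with the maximum of the tail, unless the tail has no
    element of [P]. *)
Lemma sto_list_max (A : Type) (P : A -> Prop) (lt : A -> A -> Prop) (l : list A) :
  strict_total_order_on P lt -> (exists e, P e /\ In e l) ->
  exists m, (P m /\ In m l) /\ forall e, P e -> In e l -> e <> m -> lt e m.
Proof.
intros O; induction l as [|x l IH]; intros [e [pe he]]; [destruct he|].
destruct (classic (exists e, P e /\ In e l)) as [h|h].
- destruct (IH h) as [m [[pm hm] M]].
  destruct (classic (P x /\ lt m x)) as [[px mx]|nx].
  + exists x; repeat split; simpl; auto.
    intros a pa [->|ha] ne; [congruence|].
    destruct (classic (a = m)) as [->|nm]; auto.
    exact (sto_trans O pa pm px (M a pa ha nm) mx).
  + exists m; repeat split; simpl; auto.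
    intros a pa [->|ha] ne; auto.
    destruct (sto_total O pa pm ne); tauto.
- assert (x = e) as -> by (destruct he; [auto|destruct h; eauto]).
  exists e; repeat split; simpl; auto.
  intros a pa [->|ha] ne; [congruence|destruct h; eauto].
Qed.

(** * Extremal 1-cells in the boundary of a 2-cell *)

Section Extremal.
Variables (X : complex2) (P : edge X -> Prop) (lt : edge X -> edge X -> Prop).
Hypothesis O : strict_total_order_on P lt.

Lemma highest_ex (r : face X) :
  (exists e, P e /\ in_bd e r) -> exists e, highest P lt r e.
Proof. apply sto_list_max; exact O. Qed.

Lemma highest_uniq (r : face X) a b :
  highest P lt r a -> highest P lt r b -> a = b.
Proof.
intros [[pa ha] A] [[pb hb] B]. apply NNPP; intro ne.
apply (sto_asym (a := a) (b := b) O); auto.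
Qed.

End Extremal.

(** * Equivariance under deck transformations *)

Section DeckAction.
Variables (X : complex2) (U : universal_cover X) (g : deck U).

Lemma deckE_inj (a b : edge U) : cE g a = cE g b -> a = b.
Proof.
intro e. destruct (deckE_bij g (cE g b)) as [c [_ H]].
now rewrite <- (H a e), <- (H b eq_refl).
Qed.

Lemma in_bd_deck (r : face U) e :
  in_bd e (cF g r) <-> exists e0, cE g e0 = e /\ in_bd e0 r.
Proof.
assert (E : map fst (bpath (cF g r)) = map (cE g) (map fst (bpath r))).
{ rewrite cE_bpath, !map_map. reflexivity. }
unfold in_bd. rewrite E. apply in_map_iff.
Qed.

(** Write [r] as a translate [cF g s], by surjectivity on 2-cells, and cancel [g] on 1-cells. Serves
    for the sets of all r^+ and of all r^-. *)
Lemma deck_image_iff (h : face U -> edge U) (e : edge U) :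
  (forall r, cE g (h r) = h (cF g r)) ->
  ((exists r, cE g e = h r) <-> exists r, e = h r).
Proof.
intro eqv; split; intros [r er].
- destruct (deckF_bij g r) as [s [<- _]]. exists s. apply deckE_inj.
  now rewrite er, eqv.
- exists (cF g r). now rewrite er, eqv.
Qed.

(** Every boundary 1-cell of the translate comes from one of [r], so maximality pulls back along
    [g]. *)
Lemma highest_deck (P : edge U -> Prop) (lt : edge U -> edge U -> Prop) r e :
  (forall a, P (cE g a) <-> P a) ->
  (forall a b, P a -> P b -> (lt (cE g a) (cE g b) <-> lt a b)) ->
  highest P lt r e -> highest P lt (cF g r) (cE g e).
Proof.
intros Pi Li [[pe he] M]; split; [split|].
- now apply Pi.
- apply in_bd_deck; eauto.
- intros a pa ha ne. apply in_bd_deck in ha as [b [<- hb]].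
  apply (proj1 (Pi b)) in pa. apply Li; auto. apply M; congruence.
Qed.

End DeckAction.

(** * From a totally ordered bislim structure to a staggering *)

Section FromBislim.
Variables (X : complex2) (U : universal_cover X) (B : bislim U).
Hypothesis tot : totally_ordered B.

Local Notation Plus := (fun e : edge U => exists r, e = rplus B r).
Local Notation Minus := (fun e : edge U => exists r, e = rminus B r).
Local Notation ltplus := (strict (ble B)).

Definition face_lt (r s : face U) : Prop := ltplus (rplus B r) (rplus B s).

(** The order of the 2-cells pushed forward along [rminus]. The preorder [ble] would not do:
    condition (v) concludes only about the 1-cells r^+. *)
Definition minus_lt (a b : edge U) : Prop :=
  exists r s, a = rminus B r /\ b = rminus B s /\ face_lt r s.

(** A shared r^+ would lie in both boundaries, and (iv) would put it strictly below itself. *)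
Lemma rplus_inj r s : rplus B r = rplus B s -> r = s.
Proof.
intro e. apply NNPP; intro ne.
assert (h : in_bd (rplus B r) s) by (rewrite e; apply rplus_bd).
destruct (bislim_plus ne h) as [h1 h2]. rewrite e in h2. apply h2, ble_refl.
Qed.

Lemma face_lt_sto : strict_total_order_on (fun _ => True) face_lt.
Proof.
split.
- intros r _. apply (sto_irrefl tot); eauto.
- intros r s t _ _ _. apply (sto_trans tot); eauto.
- intros r s _ _ ne. apply (sto_total tot); eauto. intro e; apply ne, rplus_inj, e.
Qed.

(** A shared r^- would lie in both boundaries, and (v) would give both [face_lt r s] and
    [face_lt s r]. *)
Lemma rminus_inj r s : rminus B r = rminus B s -> r = s.
Proof.
intro e. apply NNPP; intro ne.
apply (sto_asym (a := r) (b := s) face_lt_sto I I);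
  apply bislim_minus; auto; [rewrite <- e | rewrite e]; apply rminus_bd.
Qed.

Lemma minus_lt_rminus r s : minus_lt (rminus B r) (rminus B s) <-> face_lt r s.
Proof.
split; [|intro h; exists r, s; auto].
intros (r' & s' & er & es & h). now rewrite (rminus_inj er), (rminus_inj es).
Qed.

Lemma minus_lt_sto : strict_total_order_on Minus minus_lt.
Proof.
split.
- intros a [r ->] h. apply minus_lt_rminus in h.
  exact (sto_irrefl face_lt_sto I h).
- intros a b c [r ->] [s ->] [t ->]. rewrite !minus_lt_rminus.
  apply (sto_trans face_lt_sto); exact I.
- intros a b [r ->] [s ->] ne. rewrite !minus_lt_rminus.
  apply (sto_total face_lt_sto I I). congruence.
Qed.

Lemma strict_ble_inv (g : deck U) a b : ltplus (cE g a) (cE g b) <-> ltplus a b.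
Proof. unfold strict. now rewrite !ble_inv. Qed.

Lemma face_lt_inv (g : deck U) r s : face_lt (cF g r) (cF g s) <-> face_lt r s.
Proof. unfold face_lt. rewrite <- !rplus_inv. apply strict_ble_inv. Qed.

Lemma minus_lt_inv (g : deck U) a b : Minus a -> Minus b ->
  (minus_lt (cE g a) (cE g b) <-> minus_lt a b).
Proof.
intros [r ->] [s ->]. rewrite !rminus_inv, !minus_lt_rminus. apply face_lt_inv.
Qed.

(** This is condition (iv), read with [r] as the second 2-cell. *)
Lemma highest_rplus r : highest Plus ltplus r (rplus B r).
Proof.
split; [split; [eauto|apply rplus_bd]|].
intros a [s ->] h ne. apply bislim_plus; congruence.
Qed.

(** This is condition (v), read with [r] as the first 2-cell. *)
Lemma lowest_rminus r : lowest Minus minus_lt r (rminus B r).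
Proof.
split; [split; [eauto|apply rminus_bd]|].
intros a [s ->] h ne. apply minus_lt_rminus, bislim_minus; congruence.
Qed.

Lemma highest_rplus_eq r a : highest Plus ltplus r a -> a = rplus B r.
Proof. intro h. exact (highest_uniq tot h (highest_rplus r)). Qed.

Lemma lowest_rminus_eq r a : lowest Minus minus_lt r a -> a = rminus B r.
Proof. intro h. exact (highest_uniq (sto_flip minus_lt_sto) h (lowest_rminus r)). Qed.

Definition staggering_of_bislim : staggering U.
Proof.
refine (@Staggering X U face_lt face_lt_sto face_lt_inv
  Plus ltplus _ tot (fun g a b _ _ => strict_ble_inv g a b)
  Minus minus_lt _ minus_lt_sto minus_lt_inv _ _ _ _ _).
- intros g e. apply deck_image_iff, rplus_inv.
- intros g e. apply deck_image_iff, rminus_inv.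
- intro r. exists (rplus B r). apply highest_rplus.
- intro r. exists (rminus B r). apply lowest_rminus.
- intros r e h. rewrite (highest_rplus_eq h). apply rplus_once.
(* Once the extremal 1-cells are known to be r^+ and s^+, the goal is [face_lt r s] itself. *)
- intros r s a b h ha hb.
  now rewrite (highest_rplus_eq ha), (highest_rplus_eq hb).
- intros r s a b h ha hb.
  now rewrite (lowest_rminus_eq ha), (lowest_rminus_eq hb), minus_lt_rminus.
Defined.

End FromBislim.

(** * From a staggering to a totally ordered bislim structure *)

Section FromStaggering.
Variables (X : complex2) (U : universal_cover X) (S : staggering U).

Lemma max_plus_ex r : exists e, highest (Ep S) (ltp S) r e.
Proof. apply (highest_ex (ltp_total S)), stg_exp. Qed.

Lemma min_minus_ex r : exists e, lowest (Em S) (ltm S) r e.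
Proof. apply (highest_ex (sto_flip (ltm_total S))), stg_exm. Qed.

Definition max_plus r : edge U :=
  proj1_sig (constructive_indefinite_description _ (max_plus_ex r)).

Definition min_minus r : edge U :=
  proj1_sig (constructive_indefinite_description _ (min_minus_ex r)).

Lemma max_plusP r : highest (Ep S) (ltp S) r (max_plus r).
Proof. unfold max_plus. now destruct constructive_indefinite_description. Qed.

Lemma min_minusP r : lowest (Em S) (ltm S) r (min_minus r).
Proof. unfold min_minus. now destruct constructive_indefinite_description. Qed.

Lemma Ep_max_plus r : Ep S (max_plus r).
Proof. apply max_plusP. Qed.

Lemma Em_min_minus r : Em S (min_minus r).
Proof. apply min_minusP. Qed.

(** The choice made in [max_plus] is equivariant because the highest 1-cell is unique: both sides
    are highest in the boundary of [cF g r]. *)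
Lemma max_plus_inv (g : deck U) r : cE g (max_plus r) = max_plus (cF g r).
Proof.
apply (highest_uniq (ltp_total S) (r := cF g r)); [|apply max_plusP].
apply highest_deck; [apply Ep_inv|apply ltp_inv|apply max_plusP].
Qed.

Lemma min_minus_inv (g : deck U) r : cE g (min_minus r) = min_minus (cF g r).
Proof.
apply (highest_uniq (sto_flip (ltm_total S)) (r := cF g r)); [|apply min_minusP].
apply highest_deck; [apply Em_inv| |apply min_minusP].
intros a b pa pb. now apply ltm_inv.
Qed.

Lemma ltf_max_plus r s : ltf S r s -> ltp S (max_plus r) (max_plus s).
Proof. intro h. exact (stg_max h (max_plusP r) (max_plusP s)). Qed.

Lemma ltf_min_minus r s : ltf S r s -> ltm S (min_minus r) (min_minus s).
Proof. intro h. exact (stg_min h (min_minusP r) (min_minusP s)). Qed.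

(** Distinct 2-cells are comparable, and [max_plus] is strictly increasing. *)
Lemma max_plus_inj r s : max_plus r = max_plus s -> r = s.
Proof.
intro e. apply NNPP; intro ne.
destruct (sto_total (ltf_total S) I I ne) as [h|h]; apply ltf_max_plus in h;
  rewrite e in h; exact (sto_irrefl (ltp_total S) (Ep_max_plus s) h).
Qed.

(** Reflexive on all 1-cells as a preorder must be; membership in [Ep] is demanded because [ltp] is
    arbitrary elsewhere. *)
Definition edge_le (a b : edge U) : Prop :=
  a = b \/ (Ep S a /\ Ep S b /\ ltp S a b).

Lemma edge_le_trans a b c : edge_le a b -> edge_le b c -> edge_le a c.
Proof.
intros [->|(pa & pb & ab)]; [auto|].
intros [<-|(_ & pc & bc)]; right; repeat split; auto.
exact (sto_trans (ltp_total S) pa pb pc ab bc).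
Qed.

Lemma edge_le_inv (g : deck U) a b : edge_le (cE g a) (cE g b) <-> edge_le a b.
Proof.
unfold edge_le. rewrite !Ep_inv. split; (intros [e|(pa & pb & h)]; [left|right]).
- exact (deckE_inj e).
- repeat split; auto. now apply (ltp_inv g pa pb).
- now rewrite e.
- repeat split; auto. now apply (ltp_inv g pa pb).
Qed.

Lemma strict_edge_le a b : Ep S a -> Ep S b ->
  (strict edge_le a b <-> ltp S a b).
Proof.
intros pa pb; split.
- intros [[<-|(_ & _ & h)] n]; auto. destruct n; now left.
- intro h; split; [right; auto|]. intros [->|(_ & _ & k)].
  + exact (sto_irrefl (ltp_total S) pa h).
  + exact (sto_asym (ltp_total S) pa pb h k).
Qed.

Lemma strict_edge_le_max r s :
  strict edge_le (max_plus r) (max_plus s) <-> ltp S (max_plus r) (max_plus s).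
Proof. apply strict_edge_le; apply Ep_max_plus. Qed.

Lemma max_plus_slim r s : r <> s -> in_bd (max_plus r) s ->
  strict edge_le (max_plus r) (max_plus s).
Proof.
intros ne h. apply strict_edge_le_max.
apply (proj2 (max_plusP s)); auto using Ep_max_plus.
intro e; apply ne, max_plus_inj, e.
Qed.

Lemma min_minus_slim r s : r <> s -> in_bd (min_minus s) r ->
  strict edge_le (max_plus r) (max_plus s).
Proof.
intros ne h. apply strict_edge_le_max, ltf_max_plus.
destruct (sto_total (ltf_total S) I I ne) as [k|k]; auto.
(* If [s] preceded [r], then [min_minus s] would be strictly below [min_minus r] although it lies in
   the boundary of [r]. *)
apply ltf_min_minus in k. exfalso.
destruct (classic (min_minus s = min_minus r)) as [e|ne'].
- rewrite e in k. exact (sto_irrefl (ltm_total S) (Em_min_minus r) k).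
- apply (sto_asym (ltm_total S) (Em_min_minus s) (Em_min_minus r) k).
  apply (proj2 (min_minusP r)); auto using Em_min_minus.
Qed.

Definition bislim_of_staggering : bislim U :=
  @Bislim X U edge_le (fun a => or_introl eq_refl) edge_le_trans edge_le_inv
    max_plus min_minus
    (fun r => proj2 (proj1 (max_plusP r))) (fun r => proj2 (proj1 (min_minusP r)))
    (fun r => stg_once (max_plusP r)) max_plus_inv min_minus_inv
    max_plus_slim min_minus_slim.

Lemma bislim_of_staggering_total : totally_ordered bislim_of_staggering.
Proof.
split; cbn [ble rplus bislim_of_staggering].
- intros a [r ->]. rewrite strict_edge_le_max.
  apply (sto_irrefl (ltp_total S)), Ep_max_plus.
- intros a b c [r ->] [s ->] [t ->]. rewrite !strict_edge_le_max.
  apply (sto_trans (ltp_total S)); apply Ep_max_plus.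
- intros a b [r ->] [s ->]. rewrite !strict_edge_le_max.
  apply (sto_total (ltp_total S)); apply Ep_max_plus.
Qed.

End FromStaggering.

Theorem lemma5p9 (X : complex2) (hconn : connected X)
    (himm : immersed_attaching_maps X) (U : universal_cover X) :
  has_totally_ordered_bislim U <-> has_totally_ordered_invariant_staggering U.
Proof.
split.
- intros [B tot]. exact (inhabits (staggering_of_bislim tot)).
- intros [S]. exists (bislim_of_staggering S). apply bislim_of_staggering_total.
Qed.
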